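(* Let $l$ and $d$ be positive integers, and let $A$ be an $l$-generated associative algebra over a field (of arbitrary characteristic) satisfying the identity $x^d=0$. Then the nilpotency index of $A$ is less than $\Psi(d,d,l)$, where $$\Psi(n,d,l)=4^{5+3\log_3 4}\, l\,(nd)^{3\log_3(nd)+(5+6\log_3 4)}\,d^2.$$
   Context: Algebras are not assumed to have a unit. The nilpotency index of a nilpotent algebra $A$ is the least $N$ such that every product of $N$ elements of $A$ is zero. *)

(* Defs.v *)
From HB Require Import structures.
From mathcomp Require Import all_boot all_order all_algebra.
From mathcomp Require Import reals exp.

Set Implicit Arguments.
Unset Strict Implicit.
Unset Printing Implicit Defensive.

Import GRing.Theory.
Local Open Scope ring_scope.

(* Associative algebras over a field, without unit: [algType] requires one. *)
HB.mixin Record Lmodule_isNonUnitalAlgebra (F : fieldType) A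
    of GRing.Lmodule F A := {
  amul : A -> A -> A;
  amulA : associative amul;
  amulDl : left_distributive amul +%R;
  amulDr : right_distributive amul +%R;
  scale_amull : forall (c : F) (x y : A), c *: amul x y = amul (c *: x) y;
  scale_amulr : forall (c : F) (x y : A), c *: amul x y = amul x (c *: y)
}.

#[short(type="nonUnitalAlgType")]
HB.structure Definition NonUnitalAlgebra (F : fieldType) :=
  { A of GRing.Lmodule F A & Lmodule_isNonUnitalAlgebra F A }.

Section NonUnitalAlgebraDefs.
Variables (F : fieldType) (A : nonUnitalAlgType F).

(* x * s_0 * ... * s_(k-1), a product of (size s).+1 elements; there is no
   empty product in A. *)
Definition aprod (x : A) (s : seq A) : A := foldl amul x s.

(* x ^ d for 0 < d; the value at d = 0 is a dummy. *)
Definition apow (x : A) (d : nat) : A := aprod x (nseq d.-1 x).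

Definition subalgebra (S : A -> Prop) : Prop :=
  [/\ S 0,
      forall x y, S x -> S y -> S (x + y),
      forall (c : F) x, S x -> S (c *: x) &
      forall x y, S x -> S y -> S (amul x y)].

Definition generated_by (l : nat) (g : 'I_l -> A) : Prop :=
  forall S : A -> Prop, subalgebra S -> (forall i, S (g i)) -> forall x, S x.

Definition generated (l : nat) : Prop :=
  exists g : 'I_l -> A, generated_by g.

Definition products_vanish (N : nat) : Prop :=
  forall (x : A) (s : seq A), (size s).+1 = N -> aprod x s = 0.

(* [products_vanish 0] holds vacuously, hence the restriction to positive
   lengths; the zero algebra has nilpotency index 1. *)
Definition is_nilpotency_index (N : nat) : Prop :=
  [/\ (0 < N)%N,
      products_vanish N &
      forall M, (0 < M)%N -> products_vanish M -> (N <= M)%N].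

End NonUnitalAlgebraDefs.

Arguments generated {F} A l.
Arguments products_vanish {F} A N.
Arguments is_nilpotency_index {F} A N.

Definition log3 {R : realType} (x : R) : R := ln x / ln 3.

Definition Psi (R : realType) (n d l : nat) : R :=
  4 `^ (5 + 3 * log3 4) * l%:R *
  (n * d)%:R `^ (3 * log3 (n * d)%:R + (5 + 6 * log3 4)) * d%:R ^+ 2.

(* Main.v *)
From HB Require Import structures.
From mathcomp Require Import fingroup perm boolp zify ring lra.
Require Import Defs.
From mathcomp Require Import all_boot all_order all_algebra.
From mathcomp Require Import reals exp.
Import Order.TTheory GRing.Theory Num.Theory.
Local Open Scope ring_scope.

(** Read a product of N generators as a word of length N, and order the words of
    a given length by the integers that they denote in base l.  A word vanishes
    in A as soon as it contains a d-th power, and it is a linear combination of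
    smaller words as soon as it has a factor v_1 ... v_d such that every
    nontrivial permutation of the v_k gives a smaller word: this is the identity
    [polarization], the full linearization of x^d = 0, which holds in every
    characteristic.  By induction on the order all words of length N vanish
    ([word_eval_eq0]), and hence all products of N elements
    ([products_vanish_of_words]), once every long word is known to have one of
    the two features ([power_of_long_word]).

    Take K = 3^t >= d^2 and a word that has, for no b > 0, d positions at mutual
    distance at least b whose factors of length b strictly decrease; such
    positions would give the pieces v_k ([descent_pieces],
    [numeral_flatten_perm]).
    Fix b <= K and a residue class modulo K.  In that class there is no strictly
    decreasing chain of d factors of length b, so, colouring a position by the
    length of the longest chain that starts there, at most d - 1 nondecreasing
    colour classes occur.  If M bounds the number of distinct factors of length b
    in each residue class, then only K (d - 1) M among consecutive intervals can
    show d distinct factors in some class ([few_values_chunk]).  This is used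
    repeatedly, in smaller and smaller intervals.  On the interval obtained for b
    every class has fewer than d factors of length b; a factor of length 3b is a
    triple of those, so M = (d - 1)^3 serves for 3b, and the length of the
    interval is divided by at most K d^4 ([good_triple]).  After t steps b = K,
    and one class contains d disjoint copies of a single word of length K.  In
    that word d overlapping windows can be compared; they are distinct unless
    there is a d-th power, and taking the largest from the first copy, the second
    largest from the second copy, and so on, yields a decreasing chain
    ([good_end]).

    So all words of length about K^2 d^3 l (K d^4)^t vanish, where t is about
    2 log_3 d.  The exponent of d is 12 log_3 d + O(1), as in Psi(d,d,l), whose
    constants absorb the rest ([word_bound_lt_Psi]). *)

(** * Words as numerals *)

Section Numerals.
Local Open Scope nat_scope.
Variable l : nat.

Fixpoint numeral (u : seq nat) : nat :=
  if u is a :: u' then a * l ^ size u' + numeral u' else 0.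

Lemma numeral_cat u v : numeral (u ++ v) = numeral u * l ^ size v + numeral v.
Proof.
by elim: u => //= a u ->; rewrite size_cat expnD mulnDl mulnA addnA.
Qed.

Lemma numeral_lt u : all (ltn^~ l) u -> numeral u < l ^ size u.
Proof.
elim: u => //= a u IH /andP[al /IH ult]; rewrite expnS.
have : a.+1 * l ^ size u <= l * l ^ size u by rewrite leq_mul2r al orbT.
by apply: leq_trans; rewrite mulSn addnC -addSn leq_add2r.
Qed.

(** The prefixes decide: tails of equal length cannot make up for a difference of
    at least one unit between u and v. *)
Lemma numeral_cat_lt u v r r' : all (ltn^~ l) r' -> size r = size r' ->
  numeral v < numeral u -> numeral (v ++ r') < numeral (u ++ r).
Proof.
move=> /numeral_lt lr' sz vu; rewrite !numeral_cat sz.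
apply: leq_trans (leq_addr _ _).
apply: leq_trans (leq_mul vu (leqnn _)).
by rewrite mulSn addnC -addSn leq_add2r.
Qed.

Lemma numeral_inj u v : all (ltn^~ l) u -> all (ltn^~ l) v -> size u = size v ->
  numeral u = numeral v -> u = v.
Proof.
elim: u v => [|a u IH] [|b v] //= /andP[al lu] /andP[bl lv] [sz].
have := numeral_lt _ lu; have := numeral_lt _ lv; rewrite sz => vlt ult E.
have lpos: 0 < l ^ size v by apply: leq_trans ult.
have E1 : a = b.
  have := congr1 (divn^~ (l ^ size v)) E.
  by rewrite !divnMDl // !divn_small // !addn0.
move: E; rewrite E1 => /addnI /(IH _ lu lv sz) ->.
by [].
Qed.

End Numerals.

(** * Factors of an infinite word *)

(** Words are prefixes of functions on nat, so that factors need no side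
    condition on their position. *)
Section Words.
Local Open Scope nat_scope.
Variable w : nat -> nat.

Definition factor i b : seq nat := map w (iota i b).

Lemma size_factor i b : size (factor i b) = b.
Proof. by rewrite size_map size_iota. Qed.

Lemma factorD i a b : factor i (a + b) = factor i a ++ factor (i + a) b.
Proof. by rewrite /factor iotaD map_cat. Qed.

Lemma take_factor i a b : a <= b -> take a (factor i b) = factor i a.
Proof. by move=> ab; rewrite -(subnKC ab) factorD take_size_cat ?size_factor. Qed.

Lemma factor_shift i j m : factor i m = factor j m ->
  forall s b, s + b <= m -> factor (i + s) b = factor (j + s) b.
Proof.
move=> E s b sb.
have H k : factor (k + s) b = take b (drop s (factor k m)).
  rewrite -(subnKC (leq_trans (leq_addr b s) sb)) factorD drop_size_cat ?size_factor //.
  by rewrite take_factor //; lia.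
by rewrite !H E.
Qed.

(** A factor with period q is a power of its first q letters; the period is
    expressed by comparing the factor with its shift. *)
Lemma factor_power i q m :
  factor (i + q) (m * q) = factor i (m * q) ->
  factor i (m.+1 * q) = flatten (nseq m.+1 (factor i q)).
Proof.
elim: m => [|m IH] E; first by rewrite mul1n /= cats0.
rewrite mulSn factorD E IH //.
have := factor_shift _ _ _ E 0 (m * q); rewrite !addn0; apply.
by rewrite mulSn; lia.
Qed.

(** By [factor_power], a d-th power of a word of length q inside the first N
    letters. *)
Definition has_power d N :=
  exists i q, [/\ 0 < q, i + d * q <= N & factor (i + q) (d.-1 * q) = factor i (d.-1 * q)].

Variable l : nat.
Hypothesis wl : forall i, w i < l.

Lemma all_factor i b : all (ltn^~ l) (factor i b).
Proof. by apply/allP => _ /mapP[j _ ->] /=. Qed.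

(** On factors of a fixed length b, comparing ranks is the lexicographic order. *)
Definition rank b i := numeral l (factor i b).

Lemma rank_inj b i j : rank b i = rank b j -> factor i b = factor j b.
Proof. by apply: numeral_inj; rewrite ?all_factor ?size_factor. Qed.

Lemma rankD a b i : rank (a + b) i = rank a i * l ^ b + rank b (i + a).
Proof. by rewrite /rank factorD numeral_cat size_factor. Qed.

(** The condition i + b <= j makes the factors disjoint, so that they are prefixes
    of consecutive pieces of the word. *)
Definition has_descent n N := exists b s,
  [/\ 0 < b, size s = n, all (fun i => i + b <= N) s &
      sorted (fun i j => (i + b <= j) && (rank b j < rank b i)) s].

End Words.

(** * Intervals with few values in each residue class *)

Section Refinement.
Local Open Scope nat_scope.
Variables (v : nat -> nat) (K n x L C M : nat).
Hypothesis K0 : 0 < K.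

Let inside i := x <= i < x + C * L.
Let R i j := [&& i < j, i %% K == j %% K & v j < v i].

Definition few_values y m := forall r, r < K ->
  size (undup [seq v i | i <- iota y m & i %% K == r]) < n.

Hypothesis no_decreasing : forall s, size s = n -> all inside s -> sorted R s -> False.

(** [height i] is the length of the longest decreasing chain that continues the
    position i, which is the colour of i. *)
Let chain i k := `[< exists s, [/\ size s = k, all inside s & path R i s] >].
Let height i := \max_(k < n | chain i k) k.

Lemma height_lt j : inside j -> (height j).+1 < n /\ forall i, R i j -> height j < height i.
Proof.
move=> jr.
case: (posnP n) => [n0|npos].
  by case: (no_decreasing [::]); rewrite ?n0.
have c0 : chain j (Ordinal npos) by apply/asboolP; exists [::].
have [|k /asboolP[s [sk sr sp]] hk] := @eq_bigmax_cond _ (fun k : 'I_n => chain j k) (fun k => k).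
  by apply/card_gt0P; exists (Ordinal npos).
have hn : k.+1 < n.
  rewrite ltn_neqAle ltn_ord andbT; apply/negP => /eqP kn.
  by apply: (no_decreasing (j :: s)); rewrite /= ?sk ?kn ?jr.
rewrite /height hk; split=> // i Rij.
apply: (@leq_bigmax_cond _ (fun k : 'I_n => chain i k) (fun k => k : nat) (Ordinal hn)).
by apply/asboolP; exists (j :: s); rewrite /= sk jr Rij.
Qed.

Variable V : nat -> seq nat.
Hypothesis VM : forall r, r < K -> size (V r) <= M.
Hypothesis vV : forall i, inside i -> v i \in V (i %% K).
Hypothesis Cbig : K * n.-1 * M < C.

(** In an interval with n distinct values in some class, two positions i < j of
    the class have equal height (there are n - 1 heights) and distinct values,
    hence v i < v j, as v j < v i would make the heights differ.  Along intervals
    with the same class and height these v j increase strictly, so the triple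
    (class, height, v j) determines the interval. *)
Lemma few_values_chunk : exists2 k, k < C & few_values (x + k * L) L.
Proof.
apply: contrapT => nex.
have bad (k : 'I_C) : exists ij : nat * nat,
    [/\ x + k * L <= ij.1, ij.1 < ij.2, ij.2 < x + k.+1 * L &
        [/\ ij.1 %% K = ij.2 %% K, height ij.1 = height ij.2 & v ij.1 < v ij.2]].
  apply: contrapT => nbad; apply: nex; exists (val k); first exact: ltn_ord.
  move=> r rK; set pos := [seq i <- _ | _].
  have posP i : i \in pos -> [/\ x + k * L <= i, i < x + k.+1 * L, i %% K = r & inside i].
    rewrite mem_filter mem_iota => /andP[/eqP ir /andP[i1 i2]].
    have kC : k.+1 * L <= C * L by rewrite leq_mul2r ltn_ord orbT.
    have i3 : i < x + k.+1 * L by rewrite mulSn (addnC L) addnA.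
    by split=> //; rewrite /inside (leq_trans (leq_addr _ _) i1) (leq_trans i3) ?leq_add2l.
  have npos: 0 < n by case: (posnP n) => // n0; case: (no_decreasing [::]); rewrite ?n0.
  have key i j : i \in pos -> j \in pos -> height i = height j -> v i = v j.
    wlog ij : i j / i < j.
      move=> W; case: (ltngtP i j) => [ij|ij|->] // pi pj hij; first exact: W.
      by apply/esym/W.
    move=> /posP[i1 i2 ir iin] /posP[j1 j2 jr jin] hij.
    case: (ltngtP (v i) (v j)) => // vij; exfalso.
      by apply: nbad; exists (i, j); rewrite /= ir jr.
    have [_ /(_ i)] := height_lt _ jin; rewrite /R ij ir jr eqxx vij => /(_ isT).
    by rewrite hij ltnn.
  pose g c := v (nth 0 pos (index c (map height pos))).
  rewrite -(prednK npos) ltnS -(size_iota 0 n.-1) -(size_map g (iota _ _)).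
  apply: uniq_leq_size; first exact: undup_uniq.
  move=> c; rewrite mem_undup => /mapP[i ipos ->].
  apply/mapP; exists (height i).
    have [_ _ _ /height_lt[hi _]] := posP _ ipos.
    by rewrite mem_iota add0n /=; lia.
  have hin : height i \in map height pos by apply: map_f.
  have idx: index (height i) (map height pos) < size pos by rewrite -(size_map height) index_mem.
  apply: key => //; first exact: mem_nth.
  by rewrite -(nth_map 0 0) // nth_index.
have [f fP] := fin_all_exists bad.
pose code k := ((f k).2 %% K, height (f k).2, index (v (f k).2) (V ((f k).2 %% K))).
have kC (k : 'I_C) : k.+1 * L <= C * L by rewrite leq_mul2r ltn_ord orbT.
have fin2 k : inside (f k).2.
  by have [] := fP k; move: (kC k); rewrite /inside; lia.
have cinj : injective code.
  have nolt (k k' : 'I_C) : k < k' -> code k = code k' -> False.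
    move=> kk' [er eh ei].
    have [_ _ j1 [_ _ _]] := fP k; have [i2 ij2 j2 [rr hh vv]] := fP k'.
    have kL : k.+1 * L <= k' * L by rewrite leq_mul2r kk' orbT.
    have in1 : inside (f k').1.
      by move: (kC k'); rewrite /inside; lia.
    have vE : v (f k).2 = v (f k').2.
      have := congr1 (nth 0 (V ((f k).2 %% K))) ei.
      by rewrite nth_index ?vV // er nth_index ?vV.
    have [_ /(_ (f k).2)] := height_lt _ in1.
    have -> : R (f k).2 (f k').1.
      by rewrite /R er rr eqxx vE vv andbT; lia.
    by rewrite eh hh ltnn => /(_ isT).
  move=> k k' E; apply/val_inj; case: (ltngtP k k') => // kk'.
    by case: (nolt _ _ kk' E).
  by case: (nolt _ _ kk' (esym E)).
pose S := [seq (a, m) | a <- [seq (r, c) | r <- iota 0 K, c <- iota 0 n.-1], m <- iota 0 M].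
have szS : size S = K * n.-1 * M by rewrite !size_allpairs !size_iota.
have : size (map code (enum 'I_C)) <= size S.
  apply: uniq_leq_size; first by rewrite map_inj_uniq // enum_uniq.
  move=> _ /mapP[k _ ->]; rewrite /code.
  apply: (allpairs_f (fun a m => (a, m))); first apply: (allpairs_f (fun r c => (r, c))).
  - by rewrite mem_iota add0n /= ltn_mod.
  - by have [hi _] := height_lt _ (fin2 k); rewrite mem_iota add0n /=; lia.
  - have rK : (f k).2 %% K < K by rewrite ltn_mod.
    by rewrite mem_iota add0n /=; apply: leq_trans (VM _ rK); rewrite index_mem vV.
by rewrite size_map size_enum_ord szS leqNgt Cbig.
Qed.

End Refinement.

(** * Long words contain a power or a descent *)

Section Unavoidable.
Local Open Scope nat_scope.

(** The pigeonhole principle, with multiplicities. *)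
Lemma frequent_value (m k : nat) (D s : seq nat) :
  {subset s <= D} -> size D <= m -> m * k < size s -> exists c, k < count_mem c s.
Proof.
elim: D s m => [|c D IH] s m sD Dm ms.
  case: s sD ms => [|a s] sD; first by rewrite ltn0.
  by have := sD a; rewrite inE eqxx => /(_ isT).
case: (ltnP k (count_mem c s)) => [kc|kc]; first by exists c.
case: m Dm ms => // m Dm ms.
have sz : count_mem c s + count (fun a => a != c) s = size s := count_predC (pred1 c) s.
have [||c' kc'] := IH [seq a <- s | a != c] m _ Dm.
- move=> a; rewrite mem_filter => /andP[ac /sD]; rewrite inE => /orP[/eqP E|//].
  by rewrite E eqxx in ac.
- rewrite size_filter; move: ms; rewrite mulSn -sz => ms.
  by rewrite -(ltn_add2l k); apply: leq_trans ms _; rewrite leq_add2r; exact: kc.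
exists c'; apply: leq_trans kc' _; rewrite count_filter; apply: sub_count => a /=.
by case/andP.
Qed.

Variables (w : nat -> nat) (l n t N : nat).
Hypothesis wl : forall i, w i < l.
Hypothesis n1 : 1 < n.
Let K := 3 ^ t.
Hypothesis nK : n ^ 2 <= K.
Hypothesis nodesc : ~ has_descent w l n N.

Let K0 : 0 < K. Proof. by rewrite expn_gt0. Qed.

Let good b x L := few_values (rank w l b) K n x L.

(** Positions of one residue class are at distance at least K >= b, so a decreasing
    chain within a class is a descent. *)
Lemma no_chain b x m : 0 < b <= K -> x + m + K <= N -> forall s, size s = n ->
  all (fun i => x <= i < x + m) s ->
  sorted (fun i j => [&& i < j, i %% K == j %% K & rank w l b j < rank w l b i]) s ->
  False.
Proof.
move=> /andP[b0 bK] xm s sn sa ss; apply: nodesc; exists b, s; split=> //.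
  by apply: sub_all sa => i /=; lia.
apply: sub_sorted ss => i j /and3P[ij /eqP e ->]; rewrite andbT.
have := divn_eq i K; have := divn_eq j K; rewrite e => Ej Ei.
have : i %/ K < j %/ K.
  rewrite ltnNge; apply/negP => H.
  have : j %/ K * K <= i %/ K * K by rewrite leq_mul2r H orbT.
  lia.
move=> H; have : (i %/ K).+1 * K <= j %/ K * K by rewrite leq_mul2r H orbT.
rewrite mulSn; lia.
Qed.

Lemma good_letters L : (K * n.-1 * l).+1 * L + K <= N ->
  exists2 x, x + L + K <= N & good 1 x L.
Proof.
move=> H; set C := _.+1 in H.
have [|r _|i _|//|k kC gk] := @few_values_chunk (rank w l 1) K n 0 L C l K0 _ (fun=> iota 0 l).
- by apply: no_chain => //; rewrite K0.
- by rewrite size_iota.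
- by rewrite mem_iota /rank /factor /= muln1 addn0.
exists (0 + k * L) => //.
have : k.+1 * L <= C * L by rewrite leq_mul2r kC orbT.
by rewrite mulSn; lia.
Qed.

(** The factor of length 3b at i is made of those of length b at i, i + b and
    i + 2b, whose residue classes depend only on that of i.  The margin 2b keeps
    the last two positions inside the interval. *)
Lemma good_triple b x L L' : 0 < b -> 3 * b <= K ->
  (K * n.-1 * n.-1 ^ 3).+1 * L + 2 * b <= L' -> x + L' + K <= N ->
  good b x L' -> exists2 y, y + L + K <= N & good (3 * b) y L.
Proof.
move=> b0 bK; set C := _.+1 => CL xL gd.
pose D r := undup [seq rank w l b i | i <- iota x L' & i %% K == r].
pose comb p q s := p * l ^ (2 * b) + (q * l ^ b + s).
pose V r := [seq comb a.1 a.2 s | a <- [seq (p, q) | p <- D r, q <- D ((r + b) %% K)],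
                                  s <- D ((r + 2 * b) %% K)].
have inD i r : x <= i < x + L' -> i %% K = r -> rank w l b i \in D r.
  move=> ix ir; rewrite mem_undup; apply: map_f.
  by rewrite mem_filter mem_iota ir eqxx.
have szD r : r < K -> size (D r) <= n.-1 by move=> rK; have := gd r rK; rewrite -/(D r); lia.
have [|r rK|i ix|//|k kC gk] := @few_values_chunk (rank w l (3 * b)) K n x L C (n.-1 ^ 3) K0 _ V.
- by apply: no_chain; lia.
- rewrite !size_allpairs !expnS expn0 muln1 mulnA.
  by apply: leq_mul; [apply: leq_mul|]; apply: szD => //; rewrite ltn_mod.
- have -> : rank w l (3 * b) i =
      comb (rank w l b i) (rank w l b (i + b)) (rank w l b (i + 2 * b)).
    rewrite /comb -[3]/(1 + 2) mulnDl mul1n rankD mul2n -addnn rankD.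
    by rewrite (addnA i).
  apply/allpairsP; exists ((rank w l b i, rank w l b (i + b)), rank w l b (i + 2 * b)).
  split=> //=; first (apply/allpairsP; exists (rank w l b i, rank w l b (i + b)); split=> //=).
  + by apply: inD => //; lia.
  + by apply: inD; rewrite ?modnDml //; lia.
  + by apply: inD; rewrite ?modnDml //; lia.
exists (x + k * L) => //.
have : k.+1 * L <= C * L by rewrite leq_mul2r kC orbT.
by rewrite mulSn; lia.
Qed.

(** Equal windows at distance q < n force the period q on a stretch of length
    K - (n - 1) + q >= n q, which contains an n-th power. *)
Lemma window_inj p s s' : p + K <= N -> ~ has_power w n N -> s < n -> s' < n ->
  rank w l (K - n.-1) (p + s) = rank w l (K - n.-1) (p + s') -> s = s'.
Proof.
move=> pN nopow.
wlog ss : s s' / s < s'.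
  move=> W sn sn' E; case: (ltngtP s s') => // H; first exact: W H _ _ E.
  by apply/esym/(W _ _ H).
move=> sn sn' /(rank_inj _ _ wl) E; case: nopow; exists (p + s), (s' - s).
have nn : n.-1 * (s' - s) <= n.-1 * n.-1 by rewrite leq_mul2l; lia.
have nK' : n.-1 * n.-1 + n + n.-1 <= K.
  by apply: leq_trans nK; rewrite -mulnn; move: n1; case: (n) => // m _ /=;
     rewrite mulSn mulnS; lia.
have nq : n * (s' - s) = n.-1 * (s' - s) + (s' - s).
  by move: n1; case: (n) => // m _; rewrite mulSn addnC.
split; [by rewrite subn_gt0 | by rewrite nq; lia|].
rewrite -addnA subnKC ?(ltnW ss) //.
have := factor_shift _ _ _ _ E 0 (n.-1 * (s' - s)); rewrite !addn0 => ->//.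
lia.
Qed.

(** Among n^2 positions at distance K at most n - 1 factors of length K occur, so n
    disjoint copies P 0, P 1, ... of one factor are found.  The windows of that
    factor, sorted decreasingly as S, are picked one from each copy. *)
Lemma good_end x : x + K * n ^ 2 + K <= N -> good K x (K * n ^ 2) -> has_power w n N.
Proof.
move=> xN gd; apply: contrapT => nopow.
have xK : x %% K < K by rewrite ltn_mod.
have {gd xK} := gd _ xK; set D := undup _ => Dn.
pose f j := rank w l K (x + K * j).
have npos : 0 < n := ltnW n1.
have [|||c cn] := @frequent_value n.-1 n.-1 D (map f (iota 0 (n ^ 2))).
- move=> c /mapP[j jn ->{c}]; move: jn; rewrite mem_iota add0n => /= jn.
  rewrite mem_undup; apply: map_f.
  rewrite mem_filter mem_iota addnC mulnC modnMDl eqxx /= leq_addl /= addnC ltn_add2l.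
  by rewrite mulnC ltn_pmul2l.
- by rewrite -ltnS prednK.
- by rewrite size_map size_iota -mulnn; apply: ltn_mul; lia.
pose J := [seq j <- iota 0 (n ^ 2) | f j == c].
have szJ : n <= size J.
  by rewrite size_filter -[X in X <= _](prednK npos); move: cn; rewrite count_map.
have JP k : k < n -> nth 0 J k < n ^ 2 /\ f (nth 0 J k) = c.
  move=> kn; have : nth 0 J k \in J by apply: mem_nth; apply: leq_trans szJ.
  by rewrite mem_filter mem_iota add0n => /andP[/eqP -> /andP[_ ->]].
have Jlt k : k.+1 < n -> nth 0 J k < nth 0 J k.+1.
  move=> kn; have sJ : sorted ltn J by apply: sorted_filter (iota_ltn_sorted _ _); exact: ltn_trans.
  by move/(sortedP 0): sJ; apply; apply: leq_trans szJ.
pose K' := K - n.-1.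
pose P k := x + K * nth 0 J k.
have PN k : k < n -> P k + K <= N.
  move=> /JP[jn _]; have : K * (nth 0 J k).+1 <= K * n ^ 2 by rewrite leq_mul2l jn orbT.
  by rewrite mulnS /P; lia.
pose W s := rank w l K' (P 0 + s).
have WP k s : k < n -> s < n -> rank w l K' (P k + s) = W s.
  move=> kn sn; rewrite /W /rank; congr numeral.
  have E : factor w (P k) K = factor w (P 0) K.
    by apply: (rank_inj _ _ wl); have [_] := JP _ kn; have [_ <-] := JP _ npos.
  by apply: (factor_shift _ _ _ _ E); rewrite /K'; lia.
pose S := sort (fun s s' => W s' <= W s) (iota 0 n).
have szS : size S = n by rewrite size_sort size_iota.
have SP k : k < n -> nth 0 S k < n.
  move=> kn; have : nth 0 S k \in S by rewrite mem_nth ?szS.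
  by rewrite mem_sort mem_iota.
have Slt k : k.+1 < n -> W (nth 0 S k.+1) < W (nth 0 S k).
  move=> kn; have kn' := ltnW kn; rewrite ltn_neqAle; apply/andP; split.
    apply/negP => /eqP /(window_inj _ _ _ (PN _ npos) nopow (SP _ kn) (SP _ kn')) /eqP.
    rewrite nth_uniq ?szS ?sort_uniq ?iota_uniq //; lia.
  have : sorted (fun s s' => W s' <= W s) S by apply: sort_sorted => a b; exact: leq_total.
  by move/(sortedP 0); apply; rewrite szS.
have n1K : n.-1 < K.
  by apply: leq_trans nK; rewrite prednK // -mulnn leq_pmulr.
apply: nodesc; exists K', (mkseq (fun k => P k + nth 0 S k) n).
split; first by rewrite subn_gt0.
- by rewrite size_mkseq.
- apply/allP => i /mapP[k kn ->{i}]; move: kn; rewrite mem_iota add0n => /= kn.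
  by have := PN _ kn; have := SP _ kn; rewrite /K'; lia.
apply/(sortedP 0) => k; rewrite size_mkseq => kn; have kn' := ltnW kn.
rewrite !nth_mkseq // !WP ?SP // Slt // andbT.
have := SP _ kn; have := SP _ kn'.
have : K * (nth 0 J k).+1 <= K * nth 0 J k.+1 by rewrite leq_mul2l Jlt ?orbT.
by rewrite mulnS /P /K'; lia.
Qed.

(** The outer product has one factor for the reduction to few letters, one for the
    t triplings and one for the final interval; the summand K leaves room for the
    factors that start near the end of the interval. *)
Definition word_bound :=
  (K * n * l) * ((K * n ^ 4) ^ t * (K * n ^ 2)) + K.

Lemma power_of_long_word : word_bound <= N -> has_power w n N.
Proof.
move=> bN.
have npos : 0 < n := ltnW n1.
have lpos : 0 < l by apply: leq_trans (wl 0).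
pose len s := (K * n ^ 4) ^ (t - s) * (K * n ^ 2).
have len2 s : 2 * K <= len s.
  rewrite -[_ * K]mul1n; apply: leq_mul; first by rewrite expn_gt0 muln_gt0 K0 expn_gt0 npos.
  by rewrite mulnC leq_mul2l -mulnn (leq_trans n1) ?orbT // leq_pmulr.
have steps s : s <= t -> exists2 x, x + len s + K <= N & good (3 ^ s) x (len s).
  elim: s => [_|s IH st].
    apply: good_letters; apply: leq_trans bN; rewrite leq_add2r /len subn0 leq_mul2r.
    apply/orP; right; rewrite -{2}(prednK npos) mulnS mulnDl -add1n leq_add2r.
    by rewrite muln_gt0 K0.
  have [x xN gx] := IH (ltnW st).
  have s3 : 3 * 3 ^ s <= K by rewrite -expnS leq_exp2l.
  rewrite expnS; apply: good_triple xN gx => //; first by rewrite expn_gt0.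
  have -> : len s = (K * n ^ 4) * len s.+1.
    by rewrite /len -(subnSK st) (expnS (K * n ^ 4)) -!mulnA.
  have := len2 s.+1 => l2.
  apply: leq_trans (_ : (K * n.-1 * n.-1 ^ 3).+2 * len s.+1 <= _).
    by rewrite [X in _ <= X]mulSn addnC leq_add2r; apply: leq_trans l2; rewrite leq_mul2l; lia.
  rewrite leq_mul2r; apply/orP; right.
  rewrite -mulnA -expnS -{2}(prednK npos).
  have m0 : 0 < n.-1 by rewrite -subn1 subn_gt0.
  have : K * (n.-1 ^ 4 + 2) <= K * n.-1.+1 ^ 4.
    rewrite leq_mul2l; apply/orP; right; move: m0; case: (n.-1) => // m _.
    by rewrite -[4]/(2 * 2) !expnM -!mulnn; nia.
  by rewrite mulnDr; lia.
have [x] := steps _ (leqnn t).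
by rewrite /len subnn expn0 mul1n; exact: good_end.
Qed.

End Unavoidable.

(** * Linearization of x^d = 0 *)

Section Polarization.
Variables (R : pzRingType) (T : finType).

(** Toggling an element outside I pairs the terms with opposite signs. *)
Lemma alternating_sum (I : {set T}) : I != setT ->
  \sum_(S : {set T} | I \subset S) (-1) ^+ #|S| = 0 :> R.
Proof.
rewrite -subTset => /subsetPn[j _ jI].
rewrite (bigID (fun S : {set T} => j \in S)) /=.
rewrite (reindex_onto (fun S : {set T} => j |: S) (fun S => S :\ j)) /=; last first.
  by move=> S /andP[_ jS]; rewrite setD1K.
rewrite (eq_bigl (fun S : {set T} => (I \subset S) && (j \notin S))); last first.
  move=> S; rewrite setU11 andbT.
  have [jS|jS] := boolP (j \in S).
    rewrite andbF; apply/andP => -[_ /eqP E].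
    by have := setD11 j (j |: S); rewrite E jS.
  rewrite setU1K // eqxx !andbT.
  apply/idP/idP => IS; last exact: subset_trans IS (subsetUr _ _).
  apply/subsetP => a aI; have := subsetP IS a aI; rewrite !inE => /orP[/eqP E|//].
  by rewrite -E aI in jI.
rewrite -big_split big1 //= => S /andP[_ jS].
by rewrite cardsU1 jS exprS mulN1r addNr.
Qed.

End Polarization.

(** Inclusion-exclusion over the subsets S: the monomial of a map f has coefficient
    the alternating sum over the S that contain the image of f, which is zero
    unless f is onto, that is, a permutation. *)
Lemma polarization (R : pzRingType) (d : nat) (x : 'I_d -> R) :
  (forall S : {set 'I_d}, (\sum_(i in S) x i) ^+ d = 0) ->
  \sum_(s : 'S_d) \prod_(i < d) x (s i) = 0.
Proof.
move=> nil.
have : \sum_(S : {set 'I_d}) (-1) ^+ #|S| * (\sum_(i in S) x i) ^+ d = 0.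
  by rewrite big1 // => S _; rewrite nil mulr0.
pose F := {ffun 'I_d -> 'I_d}.
have -> : \sum_(S : {set 'I_d}) (-1) ^+ #|S| * (\sum_(i in S) x i) ^+ d =
    \sum_(f : F) \sum_(S : {set 'I_d} | [set f i | i : 'I_d] \subset S)
       (-1) ^+ #|S| * \prod_i x (f i).
  rewrite (exchange_big_dep predT) //=; apply: eq_bigr => S _.
  rewrite -big_distrr /=; congr (_ * _).
  have -> : (\sum_(i in S) x i) ^+ d = \prod_(k < d) \sum_(i in S) x i.
    by rewrite prodr_const card_ord.
  rewrite (bigA_distr_big (fun i : 'I_d => i \in S) (fun _ => x)).
  apply: eq_bigl => f; apply/ffun_onP/subsetP => [fS j /imsetP[i _ ->]|fS i]; first exact: fS.
  by apply: fS; apply/imsetP; exists i.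
under eq_bigr do rewrite -big_distrl /=.
rewrite (bigID (fun f : F => injectiveb f)) /= addrC big1 ?add0r => [|f Uf]; last first.
  rewrite alternating_sum ?mul0r //; apply: contra Uf => /eqP imT.
  have /imset_injP inj : #|[set f i | i : 'I_d]| == #|'I_d| by rewrite imT cardsT.
  by apply/injectiveP => a b; apply: inj.
rewrite (reindex (@pval _)) /=; last first.
  pose in_Sn := insubd (1%g : 'S_d).
  by exists in_Sn => /= f Uf; first apply: val_inj; apply: insubdK.
move=> E.
have : (-1) ^+ d * \sum_(s : 'S_d) \prod_(i < d) x (s i) = 0.
  rewrite -[RHS]E big_distrr /=; apply: eq_big => [s|s _]; first by rewrite (valP s).
  rewrite (eq_bigl (fun S => S == setT)) ?big_pred1_eq ?cardsT ?card_ord.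
    by congr (_ * _); apply: eq_bigr => i _; rewrite pvalE.
  have im_s : [set pval s i | i : 'I_d] = setT.
    apply/setP => i; rewrite inE; apply/imsetP; exists ((s^-1)%g i) => //.
    by rewrite pvalE permKV.
  by move=> S; rewrite im_s subTset.
by move/(congr1 (fun y => (-1) ^+ d * y)); rewrite mulrA -expr2 sqrr_sign mul1r mulr0.
Qed.

(** * The unitization of an algebra *)

(** F + A with A as an ideal: iterated products over arbitrary ranges and the
    noncommutative expansion of a product of sums require a unit. *)
Definition unitization (F : fieldType) (A : nonUnitalAlgType F) : Type := (F * A)%type.

Section Unitization.
Variables (F : fieldType) (A : nonUnitalAlgType F).
Local Notation U := (unitization F A).

HB.instance Definition _ := GRing.Zmodule.copy U (F * A)%type.

Let one : U := (1, 0).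
Let mul (a b : U) : U := (a.1 * b.1, a.1 *: b.2 + b.1 *: a.2 + amul a.2 b.2).

Let amul0r (x : A) : amul 0 x = 0.
Proof. by apply: (addrI (amul 0 x)); rewrite -amulDl !addr0. Qed.

Let amulr0 (x : A) : amul x 0 = 0.
Proof. by apply: (addrI (amul x 0)); rewrite -amulDr !addr0. Qed.

Let mulA : associative mul.
Proof.
move=> [a x] [b y] [c z]; rewrite /mul /=; congr pair; first exact: mulrA.
rewrite !amulDl !amulDr !scalerDr !scalerA -!scale_amull -!scale_amulr amulA -!addrA.
rewrite (mulrC c a) (mulrC c b); congr (_ + _); congr (_ + _).
rewrite addrCA; congr (_ + _).
by rewrite [RHS]addrCA; congr (_ + _); rewrite addrCA.
Qed.

Let mul1 : left_id one mul.
Proof. by move=> [a x]; rewrite /mul /= mul1r scale1r scaler0 amul0r !addr0. Qed.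

Let mulx1 : right_id one mul.
Proof. by move=> [a x]; rewrite /mul /= mulr1 scale1r scaler0 amulr0 addr0 add0r. Qed.

Let mulDl : left_distributive mul +%R.
Proof.
move=> [a x] [b y] [c z]; rewrite /mul /=; congr pair; first exact: mulrDl.
by rewrite scalerDl scalerDr amulDl (addrACA (a *: z)) [LHS]addrACA.
Qed.

Let mulDr : right_distributive mul +%R.
Proof.
move=> [a x] [b y] [c z]; rewrite /mul /=; congr pair; first exact: mulrDr.
by rewrite scalerDl scalerDr amulDr (addrACA (a *: y)) [LHS]addrACA.
Qed.

HB.instance Definition _ := GRing.Zmodule_isPzRing.Build U mulA mul1 mulx1 mulDl mulDr.

Definition incl (x : A) : U := (0, x).

Lemma inclD x y : incl (x + y) = incl x + incl y.
Proof. by congr pair; rewrite addr0. Qed.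

Lemma inclM x y : incl (amul x y) = incl x * incl y.
Proof. by congr pair; rewrite /= ?mulr0 // !scale0r !add0r. Qed.

Lemma inclZ c x (u : U) : u * incl (c *: x) = ((c, 0) : U) * (u * incl x).
Proof.
case: u => a y; congr pair; rewrite /= ?mulr0 //.
by rewrite amul0r scaler0 !scale0r !addr0 scalerDr scale_amulr !scalerA mulrC.
Qed.

Lemma incl0 : incl 0 = 0. Proof. by []. Qed.

Lemma incl_inj : injective incl.
Proof. by move=> x y []. Qed.

Lemma incl_sum (I : Type) (r : seq I) (P : pred I) (f : I -> A) :
  incl (\sum_(i <- r | P i) f i) = \sum_(i <- r | P i) incl (f i).
Proof. by apply: (big_morph incl inclD). Qed.

Lemma incl_aprod x s : incl (aprod x s) = incl x * \prod_(y <- s) incl y.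
Proof.
elim: s x => [|y s IH] x /=; first by rewrite big_nil mulr1.
by rewrite /aprod /= -/(aprod _ s) IH inclM big_cons mulrA.
Qed.

Lemma incl_apow x d : (0 < d)%N -> incl (apow x d) = incl x ^+ d.
Proof.
by case: d => // d _; rewrite /apow incl_aprod big_nseq exprS iter_mulr_1.
Qed.

End Unitization.
Arguments incl {F A} x.

(** * From words to products *)

Lemma all_flatten (T : Type) (P : pred T) (ss : seq (seq T)) :
  all P (flatten ss) = all (all P) ss.
Proof. by elim: ss => //= s ss IH; rewrite all_cat IH. Qed.

(** At the first place where the two lists of pieces differ, vs' has a piece that
    comes later in vs, so its prefix of length b is smaller.  The comparison is
    decided within these b letters, whatever the lengths of the pieces. *)
Lemma numeral_flatten_perm (l b : nat) (vs vs' : seq (seq nat)) :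
  all (fun v => b <= size v)%N vs -> all (all (ltn^~ l)) vs ->
  sorted (fun v v' => numeral l (take b v') < numeral l (take b v))%N vs ->
  perm_eq vs' vs -> vs' != vs ->
  (numeral l (flatten vs') < numeral l (flatten vs))%N.
Proof.
elim: vs vs' => [|v vs IH] vs'; first by move=> _ _ _ /perm_nilP->.
case: vs' => [|v' vs']; first by move=> _ _ _ /perm_size.
move=> bv lv sv pv; have szf := perm_size (perm_flatten pv).
move: (bv) (lv) => /andP[bv0 bvs] /andP[lv0 lvs] /=.
have [Ev|nv] := eqVneq v' v.
  move: pv szf; rewrite Ev /= eqseq_cons eqxx perm_cons !size_cat => pv /addnI szf ne.
  by rewrite !numeral_cat szf ltn_add2l; apply: IH => //; exact: path_sorted sv.
move=> _.
have v'in : v' \in vs by have := mem_head v' vs'; rewrite (perm_mem pv) inE (negPf nv).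
have tr : transitive (fun v v' : seq nat => numeral l (take b v') < numeral l (take b v))%N.
  by move=> y x z xy yz; exact: ltn_trans yz xy.
have lt : (numeral l (take b v') < numeral l (take b v))%N.
  by have /allP := order_path_min tr sv; apply.
have bv' := allP bvs _ v'in; have lv' := allP lvs _ v'in.
rewrite -(cat_take_drop b v') -(cat_take_drop b v) -!catA.
apply: numeral_cat_lt lt.
  have : all (all (ltn^~ l)) (v' :: vs') by rewrite (perm_all _ pv).
  rewrite /= all_cat -[X in all _ X && _](cat_take_drop b) all_cat -andbA => /andP[_].
  by rewrite all_flatten.
by rewrite !size_cat !size_drop; move: szf bv0 bv'; rewrite /= !size_cat; lia.
Qed.

Section Pieces.
Variables (w : nat -> nat) (l b N : nat).
Local Open Scope nat_scope.

(** Each piece runs up to the start of the next one, and the last up to N. *)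
Lemma descent_pieces i s :
  all (fun i => i + b <= N) (i :: s) ->
  path (fun i j => (i + b <= j) && (rank w l b j < rank w l b i)) i s ->
  exists vs, [/\ size vs = size (i :: s), all (fun v => b <= size v) vs,
    map (take b) vs = map (fun j => factor w j b) (i :: s) & flatten vs = factor w i (N - i)].
Proof.
elim: s i => [|j s IH] i /=.
  rewrite andbT => iN _; exists [:: factor w i (N - i)].
  have bN : b <= N - i by lia.
  by rewrite /= size_factor take_factor // cats0 bN.
move=> /andP[iN sN] /andP[/andP[ij _] /(IH _ sN)[vs [sv bv tv fv]]].
have jN : j + b <= N by case/andP: sN.
exists (factor w i (j - i) :: vs); split=> /=; first by rewrite sv.
- by rewrite size_factor bv andbT; lia.
- by rewrite tv take_factor //; lia.
rewrite fv -{2}(subnKC (leq_trans (leq_addr b i) ij)) -factorD; congr factor.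
lia.
Qed.
End Pieces.

Section Nil.
Variables (F : fieldType) (A : nonUnitalAlgType F) (l d : nat) (g : 'I_l -> A).
Hypothesis d1 : (1 < d)%N.
Hypothesis nilA : forall x : A, apow x d = 0.

(** Letters are natural numbers, as in numerals; those beyond l have the dummy
    value 0. *)
Definition letter (k : nat) : A := oapp g 0 (insub k).

Lemma letterE i : letter (val i) = g i.
Proof. by rewrite /letter valK. Qed.

Definition word_eval (u : seq nat) : unitization F A := \prod_(k <- u) incl (letter k).

Lemma word_eval_cat u v : word_eval (u ++ v) = word_eval u * word_eval v.
Proof. exact: big_cat. Qed.

Lemma word_eval_flatten ss : word_eval (flatten ss) = \prod_(s <- ss) word_eval s.
Proof. exact: big_flatten. Qed.

Lemma word_eval_incl u : (0 < size u)%N -> exists a, word_eval u = incl a.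
Proof.
case: u => // k u _; exists (aprod (letter k) (map letter u)).
by rewrite incl_aprod big_map /word_eval big_cons.
Qed.

Lemma word_eval_power u : (0 < size u)%N -> word_eval (flatten (nseq d u)) = 0.
Proof.
move=> /word_eval_incl[a Ea].
by rewrite word_eval_flatten big_nseq iter_mulr_1 Ea -incl_apow ?nilA // ltnW.
Qed.

Lemma sum_permuted_pieces (vs : d.-tuple (seq nat)) : all (fun v => 0 < size v)%N vs ->
  \sum_(s : 'S_d) word_eval (flatten [tuple tnth vs (s i) | i < d]) = 0.
Proof.
move=> vpos; rewrite -[RHS](@polarization _ d (fun i => word_eval (tnth vs i))); last first.
  move=> S.
  have [a Ea] : exists a : 'I_d -> A, forall i, word_eval (tnth vs i) = incl (a i).
    apply: (@fin_all_exists 'I_d _ (fun i a => word_eval (tnth vs i) = incl a)) => i.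
    apply: word_eval_incl.
    by have /allP := vpos; apply; exact: mem_tnth.
  under eq_bigr do rewrite Ea.
  by rewrite -incl_sum -incl_apow ?nilA // ltnW.
apply: eq_bigr => s _.
by rewrite word_eval_flatten big_tuple; apply: eq_bigr => i _; rewrite tnth_mktuple.
Qed.

(** Induction on the numeral of u.  In the case of a descent, the vanishing sum over
    permutations of the pieces has u as its term at the identity, and all other
    terms are smaller words. *)
Lemma word_eval_eq0 t N u : (d ^ 2 <= 3 ^ t)%N -> (word_bound l d t <= N)%N ->
  all (ltn^~ l) u -> size u = N -> word_eval u = 0.
Proof.
move=> dt bN; have [m] := ubnP (numeral l u); elim: m u => // m IH u um lu su.
have N0 : (0 < N)%N by apply: leq_trans bN; rewrite /word_bound addn_gt0 expn_gt0 orbT.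
have lpos : (0 < l)%N.
  by move: lu su N0; case: (u) => [|k u'] /=; [move=> _ <-|case/andP; case: (l)].
pose w := nth 0%N u.
have wl i : (w i < l)%N.
  have [iu|iu] := ltnP i (size u); last by rewrite /w nth_default.
  by have /allP := lu; apply; exact: mem_nth.
have Eu : u = factor w 0 N by rewrite -su -[LHS](mkseq_nth 0%N).
have split_u i : (i <= N)%N -> u = factor w 0 i ++ factor w i (N - i).
  by move=> iN; rewrite -factorD subnKC.
have [[b [s [b0 ss sN sd]]]|nodesc] := pselect (has_descent w l d N); last first.
  have [i [q [q0 iq E]]] := power_of_long_word w l d t N wl d1 dt nodesc bN.
  have iN : (i <= N)%N by apply: leq_trans iq; exact: leq_addr.
  rewrite (split_u i iN) -(subnKC (_ : d * q <= N - i)%N) ?leq_subRL // factorD !word_eval_cat.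
  have Ed : d.-1.+1 = d by exact/prednK/ltnW.
  by rewrite -{1}Ed (factor_power _ _ _ _ E) Ed word_eval_power ?size_factor // mul0r mulr0.
case: s ss sN sd => [|i s] ss sN sd; first by have := d1; rewrite -ss.
have [vs [sv bv tv fv]] := descent_pieces w l b N i s sN sd.
have iN : (i <= N)%N by case/andP: sN => iN _; apply: leq_trans iN; exact: leq_addr.
have szv : size vs == d by rewrite sv ss.
have [T ET] : exists T : d.-tuple (seq nat), T = vs :> seq _ by exists (Tuple szv).
pose lev := fun v v' : seq nat => (numeral l (take b v') < numeral l (take b v))%N.
have sortv : sorted lev vs.
  have : sorted (relpre (take b) (fun v v' => numeral l v' < numeral l v)%N) vs.
    rewrite -sorted_map tv sorted_map.
    by apply: sub_path sd => x y /andP[].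
  by [].
have uniqT : uniq T.
  rewrite ET; apply: sorted_uniq sortv => [y x z xy yz|x]; last exact: ltnn.
  exact: ltn_trans yz xy.
have Tpos : all (fun v => 0 < size v)%N T.
  by rewrite ET; apply: sub_all bv => v; exact: leq_trans.
have lvs : all (all (ltn^~ l)) vs by rewrite -all_flatten fv all_factor.
have Eu2 := split_u i iN; rewrite -fv in Eu2.
have T1 : [tuple tnth T ((1%g : 'S_d) j) | j < d] = T.
  by apply: eq_from_tnth => j; rewrite tnth_mktuple perm1.
have := sum_permuted_pieces T Tpos; rewrite (bigD1 (1%g : 'S_d)) // T1 ET.
move/(congr1 (fun y => word_eval (factor w 0 i) * y)); rewrite mulrDr mulr0 -word_eval_cat -Eu2.
rewrite big_distrr big1 ?addr0 // => p p1.
set vp := mktuple _.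
have pvp : perm_eq vp T by apply/tuple_permP; exists p.
rewrite /= -word_eval_cat; apply: IH.
- rewrite -ltnS; apply: leq_trans um; rewrite ltnS Eu2 !numeral_cat.
  rewrite (perm_size (perm_flatten pvp)) -ET ltn_add2l.
  apply: (@numeral_flatten_perm l b); rewrite ?ET // -?ET //.
  apply: contra p1 => /eqP Evp; apply/eqP/perm.permP => j; rewrite perm1.
  have /tuple_uniqP := uniqT; apply.
  have {}Evp : vp = T by apply: val_inj.
  by rewrite -[in RHS]Evp tnth_mktuple.
- rewrite all_cat all_factor // all_flatten (perm_all _ pvp) ET //.
- by rewrite size_cat (perm_size (perm_flatten pvp)) ET -size_cat -Eu2.
Qed.

End Nil.

Section LongProducts.
Variables (F : fieldType) (A : nonUnitalAlgType F) (l N : nat) (g : 'I_l -> A).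
Hypothesis gen : generated_by g.
Hypothesis words0 : forall u, all (ltn^~ l) u -> size u = N -> word_eval F A l g u = 0.

(** The generators of a word are replaced by arbitrary elements from the right: the
    elements x for which the equation holds, with all longer tails s allowed, form
    a subalgebra.  Allowing longer tails gives closure under products, as the
    second factor of a product can be moved into s. *)
Lemma long_products j u (s : seq A) : all (ltn^~ l) u ->
  (N <= size u + j)%N -> (j <= size s)%N ->
  word_eval F A l g u * \prod_(y <- s) incl y = 0.
Proof.
elim: j u s => [|j IH] u s lu uN js.
  rewrite addn0 in uN; rewrite -(cat_take_drop N u) word_eval_cat words0 ?mul0r ?size_takel //.
  by move: lu; rewrite -{1}(cat_take_drop N u) all_cat => /andP[].
case: s js => // x s js; rewrite big_cons.
pose S x := forall s, (j <= size s)%N -> word_eval F A l g u * (incl x * \prod_(y <- s) incl y) = 0.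
apply: (gen S) s js => {x}; first split.
- by move=> s _; rewrite incl0 mul0r mulr0.
- by move=> x y Sx Sy s js; rewrite inclD mulrDl mulrDr Sx // Sy // addr0.
- by move=> c x Sx s js; rewrite mulrA inclZ -!mulrA Sx // mulr0.
- move=> x y Sx _ s js; rewrite inclM -mulrA.
  by have := Sx (y :: s); rewrite big_cons; apply; exact: leqW.
move=> i s js; have := IH (u ++ [:: val i]) s.
rewrite all_cat lu /= ltn_ord size_cat addn1 addSnnS.
rewrite word_eval_cat {2}/word_eval big_seq1 letterE -mulrA.
by apply.
Qed.

Lemma products_vanish_of_words : products_vanish A N.
Proof.
move=> x s sN; apply: incl_inj; rewrite incl_aprod incl0.
have := @long_products N [::] (x :: s) isT; rewrite /= add0n sN => /(_ (leqnn _) (leqnn _)).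
by rewrite /word_eval big_nil mul1r big_cons.
Qed.

End LongProducts.

Lemma nilpotency_index_le (F : fieldType) (A : nonUnitalAlgType F) N :
  (0 < N)%N -> products_vanish A N -> exists2 M, is_nilpotency_index A M & (M <= N)%N.
Proof.
move=> N0 vN; pose P := fun M => (0 < M)%N && `[< products_vanish A M >].
have exP : exists M, P M by exists N; rewrite /P N0; apply/asboolP.
exists (ex_minn exP); case: ex_minnP => M /andP[M0 /asboolP vM] minM.
  by split=> // M' M'0 vM'; apply: minM; rewrite /P M'0; apply/asboolP.
by apply: minM; rewrite /P N0; apply/asboolP.
Qed.

(** * Comparison with Psi *)

(** With D = n^2 and 3^t <= 3 D, the dominant factor is
    (3^t n^4)^t = (3^t)^t D^(2t) <= 3 D D^(3t). *)
Lemma word_bound_le (l n t : nat) : (0 < l)%N -> (0 < n)%N -> (3 ^ t <= 3 * n ^ 2)%N ->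
  (word_bound l n t <= 30 * l * (n ^ 2) ^ (3 * t + 5))%N.
Proof.
move=> l0 n0; set D := (n ^ 2)%N => KD.
have D0 : (0 < D)%N by rewrite expn_gt0 n0.
have nD : (n <= D)%N by rewrite /D -mulnn leq_pmulr.
have Dt : ((3 ^ t * n ^ 4) ^ t <= 3 * D * D ^ (3 * t))%N.
  apply: (@leq_trans ((3 * D ^ 3) ^ t)%N).
    have [->//|t0] := posnP t; rewrite leq_exp2r //.
    have -> : (n ^ 4 = D ^ 2)%N by rewrite /D -expnM.
    rewrite [(D ^ 3)%N]expnS mulnA.
    by rewrite leq_mul2r KD orbT.
  by rewrite expnMn -expnM leq_mul2r KD orbT.
rewrite /word_bound; set K := (3 ^ t)%N in KD Dt *.
have step1 : (K * n * l * ((K * n ^ 4) ^ t * (K * n ^ 2)) <=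
    (3 * D) * D * l * ((3 * D * D ^ (3 * t)) * ((3 * D) * D)))%N.
  by do ?apply: leq_mul.
have step2 : (K <= 3 * l * D ^ (3 * t + 5))%N.
  apply: leq_trans KD _; rewrite -mulnA leq_mul2l /=.
  apply: leq_trans (leq_pmull _ l0); rewrite -{1}(expn1 D) leq_pexp2l //.
  by rewrite addnS.
apply: leq_trans (leq_add step1 step2) _.
have -> : (3 * D * D * l * (3 * D * D ^ (3 * t) * (3 * D * D)) = 27 * l * D ^ (3 * t + 5))%N.
  by rewrite expnD; ring.
by rewrite -!mulnA -mulnDl.
Qed.

Section RealBound.
Variable R : realType.

Lemma ln3_gt0 : 0 < ln 3 :> R.
Proof. by rewrite ln_gt0 // ltr1n. Qed.

Lemma log3_4_ge1 : 1 <= log3 4 :> R.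
Proof. by rewrite /log3 ler_pdivlMr ?ln3_gt0 // mul1r ler_ln ?posrE ?ltr0n // ler_nat. Qed.

(** The exponents 5 + 3 log_3 4 and 5 + 6 log_3 4 are at least 8 and 11, and the
    factor d^2 adds 1 to the latter. *)
Lemma Psi_ge (l d : nat) : (0 < d)%N ->
  4 ^+ 8 * l%:R * ((d ^ 2)%:R `^ (3 * log3 (d ^ 2)%:R + 12)) <= Psi R d d l.
Proof.
move=> d0; rewrite /Psi mulnn -(natrX _ d 2).
have D1 : 1 <= (d ^ 2)%:R :> R by rewrite ler1n expn_gt0 d0.
have a1 := log3_4_ge1.
set D := (d ^ 2)%:R in D1 *; set a := log3 4 in a1 *; set b := 3 * log3 D.
have D0 : 0 < D by apply: lt_le_trans D1.
have -> : D `^ (b + 12) = D `^ (b + 11) * D.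
  rewrite -{3}(powRr1 (ltW D0)) -powRD; first by congr (_ `^ _); ring.
  by apply/implyP => _; rewrite gt_eqF.
rewrite [leLHS]mulrA ler_wpM2r ?(ltW D0) //.
apply: ler_pM; rewrite ?mulr_ge0 ?powR_ge0 ?exprn_ge0 //.
  rewrite ler_wpM2r // -powR_mulrn // ler_powR ?ler1n //; lra.
by rewrite ler_powR //; lra.
Qed.

Lemma word_bound_lt_Psi (l d : nat) : (0 < l)%N -> (1 < d)%N ->
  (word_bound l d (up_log 3 (d ^ 2)))%:R < Psi R d d l.
Proof.
move=> l0 d1; apply: lt_le_trans (Psi_ge _ _ (ltnW d1)).
have D1 : (1 < d ^ 2)%N by rewrite -(expn0 d) ltn_exp2l.
set t := up_log 3 _.
have t0 : (0 < t)%N by rewrite up_log_gt0.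
have tD : (3 ^ t.-1 < d ^ 2)%N by rewrite up_log_gtn.
have KD : (3 ^ t <= 3 * d ^ 2)%N by rewrite -(prednK t0) expnS leq_mul2l ltnW ?orbT.
have := word_bound_le _ _ _ l0 (ltnW d1) KD; rewrite -(ler_nat R) => H.
apply: le_lt_trans H _; set D : R := (d ^ 2)%:R.
have D1' : 1 < D by rewrite ltr1n.
have D0 : 0 < D by apply: lt_trans D1'.
have tl : t%:R <= 1 + log3 D.
  rewrite -(prednK t0) -natr1 addrC lerD2l /log3 ler_pdivlMr ?ln3_gt0 //.
  rewrite mulr_natl -lnXn ?ltr0n // -natrX.
  by rewrite ler_ln ?posrE ?ltr0n ?expn_gt0 ?(ltnW d1) // /D ler_nat ltnW.
rewrite natrM natrM natrX -/D -(powR_mulrn _ (ltW D0)).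
have le_exp : D `^ (3 * t + 5)%:R <= D `^ (3 * log3 D + 12).
  by apply: ler_powR; [exact: ltW | rewrite natrD natrM; lra].
apply: le_lt_trans (ler_wpM2l _ le_exp) _; first by rewrite mulr_ge0.
rewrite ltr_pM2r ?powR_gt0 // ltr_pM2r ?ltr0n //.
by rewrite -natrX ltr_nat.
Qed.
End RealBound.

Theorem mainTheorem5 (R : realType) (F : fieldType) (A : nonUnitalAlgType F)
    (l d : nat) (hl : (0 < l)%N) (hd : (0 < d)%N)
    (hgen : generated A l)
    (hnil : forall x : A, apow x d = 0) :
  exists N : nat, is_nilpotency_index A N /\ N%:R < Psi R d d l.
Proof.
have [N [N0 vN bN]] : exists N, [/\ (0 < N)%N, products_vanish A N & N%:R < Psi R d d l].
  have [d1|d1] := ltnP 1 d.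
    exists (word_bound l d (up_log 3 (d ^ 2))); split; last exact: word_bound_lt_Psi.
      by rewrite /word_bound addn_gt0 expn_gt0 orbT.
    have [g gen] := hgen; apply: products_vanish_of_words gen _ => u lu su.
    by apply: (word_eval_eq0 F A l d g d1 hnil (up_log 3 (d ^ 2)) _ u _ (leqnn _) lu su);
       rewrite up_logP.
  have {d1 hd} d1 : d = 1%N by apply/eqP; rewrite eqn_leq d1.
  exists 1%N; split=> //; first by move=> x [|//] _; have := hnil x; rewrite d1.
  apply: lt_le_trans (Psi_ge R l d _); rewrite d1 // powR1 mulr1 -natrX -natrM ltr_nat.
  by apply: (leq_trans _ (leq_pmulr _ hl)).
have [M iM MN] := nilpotency_index_le F A N N0 vN.
by exists M; split=> //; apply: le_lt_trans bN; rewrite ler_nat.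
Qed.
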